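(* Let $G$ be a group and let $V$ be a finite-dimensional primitive irreducible complex $G$-module. Let $d\ge 3$ and let $0\ne f\in \operatorname{Sym}^d(V^* )$. If the Jacobian $J(f)$ is $G$-invariant, then the line $\mathbb C f$ is $G$-invariant.
   Context: $G$ is an arbitrary (abstract) group acting linearly on $V$. Elements of $\operatorname{Sym}^d(V^* )$ are homogeneous forms (polynomial functions) of degree $d$ on $V$, and $G$ acts on them by $(g\cdot h)(x)=h(g^{-1}x)$. For $v\in V$, $D_v$ denotes directional differentiation in direction $v$. The Jacobian of $f$ is the subspace $J(f)=\langle D_vf : v\in V\rangle\subseteq \operatorname{Sym}^{d-1}(V^* )$. A subspace $U$ is $G$-invariant if $g\cdot U=U$ for all $g\in G$. A system of imprimitivity for an irreducible module $V$ is a decomposition $V=V_1\oplus\cdots\oplus V_r$ with $r>1$ into nonzero subspaces which are permuted transitively by $G$; $V$ is primitive if it admits no such decomposition. *)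

(* Defs.v *)
From mathcomp Require Import all_boot all_order all_algebra perm.
From mathcomp Require Import all_classical all_reals all_analysis.
From mathcomp Require Import complex.

Set Implicit Arguments.
Unset Strict Implicit.
Unset Printing Implicit Defensive.

Import Order.TTheory GRing.Theory Num.Theory.
Import numFieldNormedType.Exports.

Local Open Scope classical_set_scope.
Local Open Scope ring_scope.

Section Modules.
Context {K : fieldType} {G : groupType} {V : vectType K}.
Implicit Types (rho : G -> 'End(V)) (U : {vspace V}).

Definition linear_action rho : Prop :=
  rho 1%g = \1%VF /\ forall g h : G, rho (g * h)%g = (rho g \o rho h)%VF.

Definition irreducible_module rho : Prop :=
  {:V}%VS <> 0%VS /\
  forall U, (forall g, (rho g @: U)%VS = U) -> U = 0%VS \/ U = {:V}%VS.

Definition imprimitivity_system rho (r : nat) (W : 'I_r -> {vspace V}) : Prop :=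
  [/\ (1 < r)%N,
      forall i, W i <> 0%VS,
      directv (\sum_i W i)%VS /\ (\sum_i W i)%VS = {:V}%VS,
      forall g, exists s : {perm 'I_r}, forall i, (rho g @: W i)%VS = W (s i)
    & forall i j, exists g, (rho g @: W i)%VS = W j].

Definition primitive_module rho : Prop :=
  forall (r : nat) (W : 'I_r -> {vspace V}), ~ imprimitivity_system rho W.

End Modules.

Section Forms.
Context {K : numFieldType} {V : vectType K}.
Implicit Types (f h : V -> K) (S : set (V -> K)).

(* Sym^d(V^* ), seen as a space of functions on V, is spanned by the products
   of d linear forms. *)
Definition sym_forms (d : nat) : set (V -> K) :=
  [set h | exists (m : nat) (c : 'I_m -> K) (l : 'I_m -> 'I_d -> 'Hom(V, K^o)),
    forall x, h x = \sum_i c i * \prod_j l i j x].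

Definition span_fun S : set (V -> K) :=
  [set h | exists (m : nat) (c : 'I_m -> K) (s : 'I_m -> (V -> K)),
    (forall i, S (s i)) /\ forall x, h x = \sum_i c i * s i x].

(* V carries no topology here: D_v f (x) is the derivative at t = 0 of
   t |-> f (x + t v), a function of one variable t : K. *)
Definition dirderiv (v : V) f : V -> K :=
  fun x => derive1 (fun t : K => f (x + t *: v) : K^o) 0.

Definition Jacobian f : set (V -> K) :=
  span_fun [set dirderiv v f | v in [set: V]].

Definition line_fun f : set (V -> K) := span_fun [set f].

End Forms.

Section Action.
Context {K : numFieldType} {G : groupType} {V : vectType K}.
Implicit Types (rho : G -> 'End(V)).

Definition act_fun rho (g : G) (h : V -> K) : V -> K :=
  fun x => h (rho g^-1%g x).

Definition invariant_fun rho (U : set (V -> K)) : Prop :=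
  forall g, act_fun rho g @` U = U.

End Action.

(* Main.v *)
(* The vectors v with D_v f = 0 form a submodule, which is not V by Euler's
   identity, so v |-> D_v f is injective. As J(g f) = g J(f) = J(f), there is for
   each g an endomorphism M of V with D_v (g f) = D_(M v) f, and symmetry of
   second derivatives makes M self-adjoint for the Hessian of f:
   D_w D_(M v) f = D_(M w) D_v f. Since d >= 3, such endomorphisms move freely
   between the slots of the third derivative of f, so they commute; and G
   normalizes the set they form. The translates of a joint eigenspace of this set
   are independent, permuted transitively by G and span V, so primitivity leaves
   only one of them and M is a scalar c, whence g f = c f by Euler's identity. *)
From HB Require Import structures.
Require Import Defs.
From mathcomp Require Import all_boot all_order all_algebra perm.
From mathcomp Require Import all_classical all_reals all_analysis.
From mathcomp Require Import complex spectral.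
Set Implicit Arguments.
Unset Strict Implicit.
Unset Printing Implicit Defensive.
Import Order.TTheory GRing.Theory Num.Theory.
Import numFieldNormedType.Exports.

Local Open Scope ring_scope.

(** * Homogeneous forms and their directional derivatives *)

Section Forms.
Context {K : numFieldType} {V : vectType K}.
Implicit Types (f h : V -> K) (u v w x : V).

(** Forms are built one linear factor at a time, so that rules of calculus follow by induction from
    the Leibniz rule for a linear factor. *)
Inductive form : nat -> (V -> K) -> Prop :=
| form_cst c : form 0 (fun=> c)
| form_zero d : form d (fun=> 0)
| form_add d f h : form d f -> form d h -> form d (fun x => f x + h x)
| form_scale d c f : form d f -> form d (fun x => c * f x)
| form_lin d (l : 'Hom(V, K^o)) f : form d f -> form d.+1 (fun x => l x * f x).

Lemma sym_forms_form d f : sym_forms d f -> form d f.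
Proof.
case=> m [c [l /funext ->]].
elim: m c l => [|m IH] c l.
  by under eq_fun do rewrite big_ord0; exact: form_zero.
under eq_fun do rewrite big_ord_recl.
apply: form_add; last exact: IH.
apply: form_scale; move: (l ord0) => {IH l} l0; elim: d l0 => [|d IHd] l0.
  by under eq_fun do rewrite big_ord0; exact: form_cst.
by under eq_fun do rewrite big_ord_recl; apply: form_lin; exact: IHd.
Qed.

(** [dirderiv] is a total function, so existence is tracked separately; the parameter 0 suffices
    because the base point [x] varies. *)
Definition has_dirderiv f := forall v x,
  derivable (fun t : K => f (x + t *: v) : K^o) 0 1.

Lemma is_derive_dirderiv f v x : has_dirderiv f ->
  is_derive (0 : K) 1 (fun t : K => f (x + t *: v) : K^o) (dirderiv v f x).
Proof.
by move=> sf; apply: DeriveDef; [exact: sf | rewrite /dirderiv derive1E].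
Qed.

Lemma dirderiv_unique f df :
  (forall v x, is_derive (0 : K) 1 (fun t : K => f (x + t *: v) : K^o) (df v x)) ->
  has_dirderiv f /\ forall v, dirderiv v f = df v.
Proof.
move=> Df; split=> [v x|v]; first exact: (@ex_derive _ _ _ _ _ _ _ (Df v x)).
by apply/funext => x; rewrite /dirderiv derive1E derive_val.
Qed.

Lemma dirderiv_cst (c : K) : has_dirderiv (fun=> c) /\
  forall v, dirderiv v (fun=> c) = fun=> 0.
Proof. by apply: dirderiv_unique => v x; exact: is_derive_cst. Qed.

Lemma dirderiv_add f h : has_dirderiv f -> has_dirderiv h ->
  has_dirderiv (fun x => f x + h x) /\
  forall v, dirderiv v (fun x => f x + h x)
          = fun x => dirderiv v f x + dirderiv v h x.
Proof.
move=> sf sh; apply: dirderiv_unique => v x.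
exact: is_deriveD (is_derive_dirderiv v x sf) (is_derive_dirderiv v x sh).
Qed.

Lemma dirderiv_scale (c : K) f : has_dirderiv f ->
  has_dirderiv (fun x => c * f x) /\
  forall v, dirderiv v (fun x => c * f x) = fun x => c * dirderiv v f x.
Proof.
move=> sf; apply: dirderiv_unique => v x.
exact: (@is_deriveZ _ _ _ _ c _ _ _ (is_derive_dirderiv v x sf)).
Qed.

Lemma dirderiv_lin (l : 'Hom(V, K^o)) f : has_dirderiv f ->
  has_dirderiv (fun x => l x * f x) /\
  forall v, dirderiv v (fun x => l x * f x)
          = fun x => l v * f x + l x * dirderiv v f x.
Proof.
move=> sf; apply: dirderiv_unique => v x.
have Dl : is_derive (0 : K) 1 (fun t : K => l (x + t *: v) : K) (l v : K).
  have -> : (fun t : K => l (x + t *: v) : K) = cst (l x : K) + id * cst (l v : K).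
    by apply/funext => t; rewrite linearD linearZ.
  apply: is_derive_eq.
  by rewrite scaler0 !add0r -[RHS]mulr1.
have := is_deriveM Dl (is_derive_dirderiv v x sf).
move=> H; apply: (is_derive_eq H); rewrite scale0r addr0.
by rewrite addrC; congr (_ + _); exact: mulrC.
Qed.

Lemma form_has_dirderiv d f : form d f -> has_dirderiv f.
Proof.
elim=> {d f} [c|d|d f h _ sf _ sh|d c f _ sf|d l f _ sf].
- exact: (dirderiv_cst c).1.
- exact: (dirderiv_cst 0).1.
- exact: (dirderiv_add sf sh).1.
- exact: (dirderiv_scale c sf).1.
- exact: (dirderiv_lin l sf).1.
Qed.

(** As [d.-1] is 0 for [d = 0], the induction carries the second clause: [l] times the derivative of
    a constant must again be a form of degree 0. *)
Lemma form_dirderiv_pred d f v : form d f ->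
  form d.-1 (dirderiv v f) /\ (d = 0%N -> dirderiv v f = fun=> 0).
Proof.
elim=> {d f} [c|d|d f h Ff [If Zf] Fh [Ih Zh]|d c f Ff [If Zf]|d l f Ff [If Zf]].
- by rewrite (dirderiv_cst c).2; split=> //; exact: form_zero.
- by rewrite (dirderiv_cst 0).2; split=> //; exact: form_zero.
- rewrite (dirderiv_add (form_has_dirderiv Ff) (form_has_dirderiv Fh)).2.
  split=> [|d0]; first exact: form_add.
  by apply/funext => x; rewrite Zf // Zh // addr0.
- rewrite (dirderiv_scale c (form_has_dirderiv Ff)).2.
  split=> [|d0]; first exact: form_scale.
  by apply/funext => x; rewrite Zf // mulr0.
- rewrite (dirderiv_lin l (form_has_dirderiv Ff)).2; split=> //=.
  apply: form_add; first exact: form_scale.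
  case: d Ff If Zf => [|d] Ff If Zf; last exact: form_lin.
  rewrite Zf //; under eq_fun do rewrite mulr0.
  exact: form_zero.
Qed.

Lemma form_dirderiv d f v : form d.+1 f -> form d (dirderiv v f).
Proof. by move=> Ff; have [] := form_dirderiv_pred v Ff. Qed.

(** In the product case $D_uD_v(lf) = l(v)D_uf + l(u)D_vf + l\,D_uD_vf$, which is symmetric in $u$
    and $v$. *)
Lemma dirderivC d f u v : form d f ->
  dirderiv u (dirderiv v f) = dirderiv v (dirderiv u f).
Proof.
elim=> {d f} [c|d|d f h Ff If Fh Ih|d c f Ff If|d l f Ff If].
- by rewrite !(dirderiv_cst _).2.
- by rewrite !(dirderiv_cst _).2.
- have [sf sh] := (form_has_dirderiv Ff, form_has_dirderiv Fh).
  have sD g e w : form e g -> has_dirderiv (dirderiv w g).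
    by move=> /(form_dirderiv_pred w)[/form_has_dirderiv].
  rewrite !(dirderiv_add sf sh).2.
  by rewrite !(dirderiv_add (sD _ _ _ Ff) (sD _ _ _ Fh)).2 If Ih.
- have sf := form_has_dirderiv Ff.
  have sD w : has_dirderiv (dirderiv w f).
    by have [/form_has_dirderiv] := form_dirderiv_pred w Ff.
  by rewrite !(dirderiv_scale c sf).2 !(dirderiv_scale c (sD _)).2 If.
- have sf := form_has_dirderiv Ff.
  have sD w : has_dirderiv (dirderiv w f).
    by have [/form_has_dirderiv] := form_dirderiv_pred w Ff.
  rewrite !(dirderiv_lin l sf).2.
  have sl w := dirderiv_lin l (sD w).
  have sc w := dirderiv_scale (l w) sf.
  rewrite !(dirderiv_add (sc _).1 (sl _).1).2 !(sl _).2 !(sc _).2 If.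
  by apply/funext => x; rewrite !addrA [X in X + _ = _]addrC.
Qed.

(** The proof is by induction on the form: for a general function, existence of directional
    derivatives does not give linearity in the direction. *)
Lemma dirderiv_linear d f (a : K) u v x : form d f ->
  dirderiv (a *: u + v) f x = a * dirderiv u f x + dirderiv v f x.
Proof.
elim=> {d f} [c|d|d f h Ff If Fh Ih|d c f Ff If|d l f Ff If].
- by rewrite !(dirderiv_cst _).2 mulr0 addr0.
- by rewrite !(dirderiv_cst _).2 mulr0 addr0.
- rewrite !(dirderiv_add (form_has_dirderiv Ff) (form_has_dirderiv Fh)).2 If Ih.
  by rewrite mulrDr addrACA.
- by rewrite !(dirderiv_scale c (form_has_dirderiv Ff)).2 If mulrDr mulrCA.
- rewrite !(dirderiv_lin l (form_has_dirderiv Ff)).2 If linearP.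
  by rewrite !mulrDr mulrDl -[(a *: _) * _]mulrA [l x * (a * _)]mulrCA addrACA.
Qed.

Lemma dirderiv0 d f : form d f -> dirderiv 0 f = fun=> 0.
Proof.
move=> Ff; apply/funext => x; have := dirderiv_linear (-1) 0 0 x Ff.
by rewrite scaler0 addr0 mulN1r addNr.
Qed.

Lemma euler d f x : form d f -> dirderiv x f x = d%:R * f x.
Proof.
elim=> {d f} [c|d|d f h Ff If Fh Ih|d c f Ff If|d l f Ff If].
- by rewrite !(dirderiv_cst _).2 mul0r.
- by rewrite !(dirderiv_cst _).2 mulr0.
- rewrite !(dirderiv_add (form_has_dirderiv Ff) (form_has_dirderiv Fh)).2 If Ih.
  by rewrite mulrDr.
- by rewrite !(dirderiv_scale c (form_has_dirderiv Ff)).2 If mulrCA.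
- rewrite !(dirderiv_lin l (form_has_dirderiv Ff)).2 If.
  by rewrite [l x * (d%:R * _)]mulrCA -[in RHS]natr1 mulrDl mul1r addrC.
Qed.

(** In characteristic 0, Euler's identity recovers a form of positive degree from its
    derivatives. *)
Lemma form_dirderiv_inj d f h : form d.+1 f -> form d.+1 h ->
  (forall v, dirderiv v f = dirderiv v h) -> f = h.
Proof.
move=> Ff Fh Dfh; apply/funext => x.
have d0 : d.+1%:R != 0 :> K by rewrite pnatr_eq0.
by apply: (mulfI d0); rewrite -(euler x Ff) -(euler x Fh) Dfh.
Qed.

Lemma form_dirderiv_eq0 d f : form d.+1 f ->
  (forall v, dirderiv v f = fun=> 0) -> f = fun=> 0.
Proof.
move=> Ff D0; apply: (form_dirderiv_inj Ff (form_zero d.+1)) => v.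
by rewrite D0 (dirderiv_cst 0).2.
Qed.

Lemma dirderiv_comp (B : 'End(V)) f v :
  dirderiv v (fun x => f (B x)) = fun x => dirderiv (B v) f (B x).
Proof.
apply/funext => x; rewrite /dirderiv; congr (derive1 _ 0).
by apply/funext => t; rewrite linearD linearZ.
Qed.

Lemma form_comp d f (B : 'End(V)) : form d f -> form d (fun x => f (B x)).
Proof.
elim=> {d f} [c|d|d f h Ff If Fh Ih|d c f Ff If|d l f Ff If].
- exact: form_cst.
- exact: form_zero.
- exact: form_add.
- exact: form_scale.
- have -> : (fun x => l (B x) * f (B x)) = fun x => (l \o B)%VF x * f (B x).
    by apply/funext => x; rewrite comp_lfunE.
  exact: form_lin.
Qed.

(** Linearity in the direction collapses a combination of derivatives into a single one. *)
Lemma Jacobian_form d f k : form d f ->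
  Jacobian f k -> exists w, k = dirderiv w f.
Proof.
move=> Ff [m [c [s [Js /funext ->]]]].
elim: m c s Js => [|m IH] c s Js.
  by exists 0; rewrite (dirderiv0 Ff); apply/funext => x; rewrite big_ord0.
have [|w Hw] := IH (c \o lift ord0) (s \o lift ord0); first by move=> i; exact: Js.
have [w0 _ Hw0] := Js ord0.
exists (c ord0 *: w0 + w); apply/funext => x.
by rewrite big_ord_recl (dirderiv_linear _ _ _ _ Ff) -Hw -Hw0.
Qed.

Lemma dirderiv_Jacobian f w : Jacobian f (dirderiv w f).
Proof.
exists 1%N, (fun=> 1), (fun=> dirderiv w f); split=> [_|x].
  by exists w.
by rewrite big_ord1 mul1r.
Qed.

End Forms.

(** * Subspaces and independence of weight spaces *)

Section Spaces.
Context {K : fieldType} {V : vectType K}.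

(** Take a subspace of maximal dimension inside [P]: adjoining the line of any [v] in [P] stays
    inside [P], so [v] was already there. *)
Lemma submod_vspace (P : V -> Prop) : P 0 ->
  (forall a u v, P u -> P v -> P (a *: u + v)) ->
  exists U : {vspace V}, forall v, v \in U <-> P v.
Proof.
move=> P0 Plin.
pose sub n := `[< exists2 U : {vspace V}, \dim U = n & forall v, v \in U -> P v >].
have ex_sub : exists n, sub n.
  exists 0%N; apply/asboolP; exists 0%VS; rewrite ?dimv0 // => v.
  by rewrite memv0 => /eqP ->.
have sub_le n : sub n -> (n <= \dim {:V})%N.
  by move/asboolP => [U <- _]; rewrite dimvS // subvf.
case: (ex_maxnP ex_sub sub_le) => n /asboolP[U dimU UP] maxn.
exists U => v; split=> [|Pv]; first exact: UP.
have : sub (\dim (<[v]> + U)%VS).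
  apply/asboolP; exists (<[v]> + U)%VS => // w /memv_addP[_ /vlineP[a ->]] [u Uu ->].
  exact/Plin/UP.
move/maxn => le_dim; rewrite -dimU in le_dim.
have /eqP -> : U == (<[v]> + U)%VS by rewrite eqEdim addvSr.
by apply: (subvP (addvSl _ _)); exact: memv_line.
Qed.

(* If A_j in calA separates l_i from l_j, the product over j != i of the operators
   A_j - l_j(A_j) kills every W_j with j != i and acts on W_i by a nonzero scalar. *)
Lemma directv_weights r (W : 'I_r -> {vspace V}) (l : 'I_r -> 'End(V) -> K)
    (calA : 'End(V) -> Prop) :
  (forall i A v, calA A -> v \in W i -> A v = l i A *: v) ->
  (forall i j, i != j -> exists2 A, calA A & l i A <> l j A) ->
  directv (\sum_i W i).
Proof.
move=> lW lsep; apply/directv_sum_independent => u Wu sum0 i _.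
(* The value 0 is a default for [j = i], an index left out of the list [s] below. *)
pose sep j := if pselect (i != j) is left ne then sval (cid2 (lsep i j ne)) else 0.
have sepP j : i != j -> calA (sep j) /\ l i (sep j) <> l j (sep j).
  rewrite /sep; case: pselect => // ne _; by case: cid2.
pose step (f : 'End(V)) j := ((sep j - l j (sep j) *: \1) \o f)%VF.
pose P (s : seq 'I_r) := foldl step \1%VF s.
have PE s k : {in s, forall j, i != j} ->
    P s (u k) = (\prod_(j <- s) (l k (sep j) - l j (sep j))) *: u k.
  elim/last_ind: s => [|s j IH] sne; first by rewrite big_nil scale1r id_lfunE.
  rewrite /P foldl_rcons -/(P s) /step comp_lfunE IH; last first.
    by move=> j' js; apply: sne; rewrite mem_rcons inE js orbT.
  have [Aj _] : calA (sep j) /\ l i (sep j) <> l j (sep j).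
    by apply: sepP; apply: sne; rewrite mem_rcons inE eqxx.
  rewrite linearZ /= add_lfunE opp_lfunE scale_lfunE id_lfunE (lW k _ _ Aj (Wu k isT)).
  by rewrite -scalerBl scalerA -cats1 big_cat big_seq1.
pose s := [seq j <- index_enum 'I_r | i != j].
have sne : {in s, forall j, i != j} by move=> j; rewrite mem_filter => /andP[].
have := congr1 (P s) sum0; rewrite linear0 linear_sum (bigD1 i) //=.
(* Each [k] other than [i] occurs in [s], and its own factor [l k (sep k) - l k (sep k)] kills
   [u k]. *)
rewrite [X in _ + X]big1 ?addr0; last first.
  move=> k ki; rewrite PE //.
  have sk : k \in s by rewrite mem_filter eq_sym ki mem_index_enum.
  by rewrite (bigD1_seq k) ?filter_uniq ?index_enum_uniq //= subrr mul0r scale0r.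
rewrite PE // => /eqP; rewrite scaler_eq0 => /orP[|/eqP //].
rewrite prodf_seq_eq0 => /hasP[j js] /andP[_]; rewrite subr_eq0 => /eqP.
by case: (sepP j (sne j js)).
Qed.

End Spaces.

(** * Joint eigenvectors of commuting operators *)

Section Eigen.
Context {K : numClosedFieldType} {V : vectType K}.

Lemma stable_eigenvector (U : {vspace V}) (A : 'End(V)) :
  U != 0%VS -> (forall v, v \in U -> A v \in U) ->
  exists a v, [/\ v \in U, v != 0 & A v = a *: v].
Proof.
move=> U0 AU.
pose b := vbasis U.
(* Row [i] holds the coordinates of the image of the [i]-th basis vector, so a row eigenvector of
   [M] lists the coordinates of an eigenvector of [A] in [U]. *)
pose M := \matrix_(i < \dim U, j < \dim U) coord b j (A b`_i).
have [|a /eigenvalueP[w wM w0]] := @eigenvalue_closed K _ M; first by rewrite lt0n dimv_eq0.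
have bas := vbasisP U.
pose v := \sum_i w 0 i *: b`_i.
have bU (i : 'I_(\dim U)) : b`_i \in U.
  by apply/vbasis_mem/mem_nth; rewrite size_tuple.
have cv j : coord b j v = w 0 j.
  by rewrite coord_sum_free // (basis_free bas).
have vU : v \in U by apply: rpred_sum => i _; exact: rpredZ.
exists a, v; split=> //.
  apply: contra w0 => /eqP v0; apply/eqP/rowP => j; rewrite -cv v0 mxE.
  by rewrite linear0.
rewrite (coord_basis bas (AU v vU)) [in RHS](coord_basis bas vU) scaler_sumr.
apply: eq_bigr => j _; rewrite scalerA; congr (_ *: _); rewrite cv.
move/rowP/(_ j): wM; rewrite !mxE => <-.
rewrite /v !linear_sum /=; apply: eq_bigr => i _.
by rewrite !linearZ /= !mxE.
Qed.

Lemma commuting_joint_eigenspace (calA : 'End(V) -> Prop) :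
  {:V}%VS != 0%VS ->
  (forall A B, calA A -> calA B -> (A \o B = B \o A)%VF) ->
  exists (l : 'End(V) -> K) v, v != 0 /\ forall A, calA A -> A v = l A *: v.
Proof.
move=> V0 calAC.
(* Induction on the dimension of a stable [U]: either every operator is scalar on [U], or some
   operator has a nonzero proper eigenspace in [U], which is stable by commutation. *)
suff H n (U : {vspace V}) : (\dim U <= n)%N -> U != 0%VS ->
    (forall A v, calA A -> v \in U -> A v \in U) ->
    exists (l : 'End(V) -> K) v, v != 0 /\ forall A, calA A -> A v = l A *: v.
  by apply: (H _ {:V}%VS (leqnn _) V0) => *; exact: memvf.
elim: n U => [|n IH] U dimU U0 AU.
  by move: dimU U0; rewrite leqn0 dimv_eq0 => /eqP ->; rewrite eqxx.
have [sc|] := pselect (forall A, calA A -> exists a, forall v, v \in U -> A v = a *: v).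
  pose l A := if pselect (calA A) is left h then sval (cid (sc A h)) else 0.
  exists l, (vpick U); rewrite vpick0; split=> // A cA.
  rewrite /l; case: pselect => // h; case: cid => a /= -> //.
  exact: memv_pick.
move/existsNP => [A /not_implyP[cA nsc]].
have [a [v [vU v0 Av]]] := stable_eigenvector U0 (fun w => AU A w cA).
pose U' := (U :&: lker (A - a *: \1%VF))%VS.
have memU' w : (w \in U') = (w \in U) && (A w == a *: w).
  by rewrite memv_cap memv_ker add_lfunE opp_lfunE scale_lfunE id_lfunE subr_eq0.
apply: (IH U').
- rewrite -ltnS; apply: leq_trans dimU; rewrite ltn_neqAle dimvS ?capvSl // andbT.
  apply/negP => /eqP dimE; apply: nsc; exists a => w wU.
  have /eqP UE : U' == U by rewrite eqEdim capvSl dimE /=.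
  by move: wU; rewrite -UE memU' => /andP[_ /eqP].
- apply/negP => /eqP U'0; have : v \in U' by rewrite memU' vU Av eqxx.
  by rewrite U'0 memv0 (negPf v0).
- move=> B w cB; rewrite !memU' => /andP[wU /eqP Aw]; rewrite AU //=.
  by rewrite -!comp_lfunE (calAC A B cA cB) comp_lfunE Aw linearZ.
Qed.
End Eigen.

(** * Group actions on vectors and subspaces *)

Section LinearAction.
Context {K : fieldType} {G : groupType} {V : vectType K}.
Variable rho : G -> 'End(V).
Hypothesis rho_lin : linear_action rho.

Lemma linear_actionM g h v : rho (g * h)%g v = rho g (rho h v).
Proof. by rewrite rho_lin.2 comp_lfunE. Qed.

Lemma linear_actionK g v : rho g^-1%g (rho g v) = v.
Proof. by rewrite -linear_actionM mulVg rho_lin.1 id_lfunE. Qed.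

Lemma linear_actionVK g v : rho g (rho g^-1%g v) = v.
Proof. by rewrite -linear_actionM mulgV rho_lin.1 id_lfunE. Qed.

Lemma mem_linear_action g (U : {vspace V}) v :
  (v \in rho g @: U)%VS = (rho g^-1%g v \in U).
Proof.
apply/memv_imgP/idP => [[u Uu ->]|Uv]; first by rewrite linear_actionK.
by exists (rho g^-1%g v); rewrite ?linear_actionVK.
Qed.

Lemma limg_linear_actionM g h (U : {vspace V}) :
  (rho (g * h)%g @: U = rho g @: (rho h @: U))%VS.
Proof. by rewrite rho_lin.2 limg_comp. Qed.

Lemma invariant_vspace (U : {vspace V}) :
  (forall g v, v \in U -> rho g v \in U) -> forall g, (rho g @: U)%VS = U.
Proof.
move=> HU g; apply/vspaceP => v; rewrite mem_linear_action; apply/idP/idP.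
  by move=> /(HU g); rewrite linear_actionVK.
exact: HU.
Qed.

End LinearAction.

(** * Clifford's argument for a commuting family normalized by the group *)

Section Clifford.
Context {K : numClosedFieldType} {G : groupType} {V : vectType K}.
Variable rho : G -> 'End(V).
Hypothesis rho_lin : linear_action rho.

Lemma primitive_normalized_scalar (calA : 'End(V) -> Prop) :
  irreducible_module rho -> primitive_module rho ->
  (forall A B, calA A -> calA B -> (A \o B = B \o A)%VF) ->
  (forall g A, calA A -> calA (rho g \o (A \o rho g^-1%g))%VF) ->
  forall A, calA A -> exists a, forall v, A v = a *: v.
Proof.
move=> [V0 irr] prim calAC calAJ.
have [l [v0 [v0n0 lv0]]] := commuting_joint_eigenspace (introN eqP V0) calAC.
(* The weight carried by the translate by [g] of the joint eigenspace of weight [l]. *)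
pose lJ g (A : 'End(V)) := l (rho g^-1%g \o (A \o rho g))%VF.
have calAV g A : calA A -> calA (rho g^-1%g \o (A \o rho g))%VF.
  by move=> /(calAJ g^-1%g); rewrite invgK.
have [|a u v Pu Pv A cA|W WP] :=
  @submod_vspace _ V (fun v => forall A, calA A -> A v = l A *: v).
- by move=> A _; rewrite linear0 scaler0.
- by rewrite linearP /= (Pu A cA) (Pv A cA) scalerDr !scalerA mulrC.
pose E g := (rho g @: W)%VS.
(* A translate is the full eigenspace of its weight, so distinct translates have distinct weights
   and are independent. *)
have EP g v : v \in E g <-> forall A, calA A -> A v = lJ g A *: v.
  rewrite (mem_linear_action rho_lin); split=> [/WP H A cA|H].
    have := congr1 (rho g) (H _ (calAV g A cA)).
    by rewrite !comp_lfunE !(linear_actionVK rho_lin) linearZ /= (linear_actionVK rho_lin).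
  apply/WP => A cA; have := congr1 (rho g^-1%g) (H _ (calAJ g A cA)).
  rewrite !comp_lfunE (linear_actionK rho_lin) linearZ /= => ->; congr (l _ *: _).
  by apply/lfunP => x; rewrite !comp_lfunE !(linear_actionK rho_lin).
have E_neq0 g : E g <> 0%VS.
  move=> E0; have : rho g v0 \in E g.
    by rewrite (mem_linear_action rho_lin) (linear_actionK rho_lin); exact/WP.
  by rewrite E0 memv0 => /eqP r0; move: v0n0; rewrite -(linear_actionK rho_lin g v0) r0 linear0 eqxx.
have Edirect r (s : 'I_r -> G) : injective (E \o s) -> directv (\sum_i E (s i)).
  move=> injE; apply: (@directv_weights _ _ _ _ (lJ \o s) calA).
    by move=> i A v cA /EP; apply.
  move=> i j ij; apply: contrapT => nsep; move/eqP: ij; apply; apply: injE.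
  have same A : calA A -> lJ (s i) A = lJ (s j) A.
    by move=> cA; apply: contrapT => ne; apply: nsep; exists A.
  by apply/vspaceP => v; apply/idP/idP => /EP H; apply/EP => A cA; rewrite H // same.
(* The orbit of W is finite because distinct translates are independent. *)
pose orb r := `[< exists s : 'I_r -> G, injective (E \o s) >].
have orb_ex : exists r, orb r.
  by exists 0%N; apply/asboolP; exists (fun=> 1%g) => -[].
have orb_le r : orb r -> (r <= \dim {:V})%N.
  move=> /asboolP[s /Edirect/directvP /= dimS].
  apply: leq_trans (dimvS (subvf (\sum_i E (s i))%VS)).
  rewrite dimS -[X in (X <= _)%N]card_ord -sum1_card leq_sum // => i _.
  by rewrite lt0n dimv_eq0; exact/eqP/E_neq0.
case: (ex_maxnP orb_ex orb_le) => r /asboolP[s injs] maxr.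
(* Otherwise prepending [h] to [s] would give [r.+1] distinct translates, against the maximality of
   [r]. *)
have full h : exists i, E h = E (s i).
  apply: contrapT => nh.
  suff : orb r.+1 by move/maxr; rewrite ltnn.
  apply/asboolP; exists (fun i => if unlift ord0 i is Some j then s j else h).
  move=> i j /=; case: unliftP => [i' ->|->]; case: unliftP => [j' ->|->] //.
  - by move/injs => ->.
  - by move=> Ei; case: nh; exists i'.
  - by move=> Ej; case: nh; exists j'.
have EM g h : (rho g @: E h)%VS = E (g * h)%g by rewrite /E (limg_linear_actionM rho_lin).
have sumE : (\sum_i E (s i))%VS = {:V}%VS.
  have [|S0|//] := irr (\sum_i E (s i))%VS.
    apply: (invariant_vspace rho_lin) => g v /memv_sumP[u Eu ->].
    rewrite linear_sum; apply: rpred_sum => i _.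
    have [j Ej] := full (g * s i)%g.
    have : rho g (u i) \in E (s j) by rewrite -Ej -EM memv_img // Eu.
    by apply: subvP; exact: (sumv_sup j).
  have [i Ei] := full 1%g; case: (E_neq0 (s i)); apply/eqP.
  by rewrite -subv0 -S0 (sumv_sup i).
have [r_gt1|r_le1] := ltnP 1 r.
  case: (prim r (E \o s)); split=> //.
  - by move=> i; exact: E_neq0.
  - by split=> //; exact: Edirect.
  - move=> g; pose p i := sval (cid (full (g * s i)%g)).
    have pP i : E (g * s i)%g = E (s (p i)) by rewrite /p; case: cid.
    have p_inj : injective p.
      move=> i j pij; apply: injs; have : E (g * s i)%g = E (g * s j)%g by rewrite !pP pij.
      rewrite -!EM => /(congr1 (fun U => rho g^-1%g @: U)%VS).
      by rewrite !EM !mulKg.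
    by exists (perm p_inj) => i; rewrite permE /= EM pP.
  - by move=> i j; exists (s j * (s i)^-1)%g; rewrite /= EM -mulgA mulVg mulg1.
(* With at most one index, [E 1] is the only summand and fills [V]. *)
have Wfull : E (1%g) = {:V}%VS.
  have [i Ei] := full 1%g; rewrite -sumE Ei (bigD1 i) //= big1 ?addv0 // => j.
  case/eqP; apply: ord_inj; case: i j {Ei} => [[|i] ri] [[|j] rj] //=;
    by move: (leq_trans ri r_le1) (leq_trans rj r_le1).
move=> A cA; exists (lJ 1%g A) => v.
by apply: (EP 1%g v).1 => //; rewrite Wfull memvf.
Qed.

End Clifford.

(** * Hessian-self-adjoint endomorphisms of a form with invariant Jacobian *)

Section InvariantJacobian.
Context {K : numFieldType} {G : groupType} {V : vectType K}.
Context {rho : G -> 'End(V)} {n : nat} {f : V -> K}.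
Hypothesis rho_lin : linear_action rho.
Hypothesis irr : irreducible_module rho.
Hypothesis formf : form n.+3 f.
Hypothesis f_neq0 : f <> fun=> 0.
Hypothesis invJ : invariant_fun rho (Jacobian f).

Lemma act_Jacobian g k : Jacobian f k -> Jacobian f (act_fun rho g k).
Proof. by move=> Jk; rewrite -(invJ g); exists k. Qed.

Lemma dirderiv_act g v h :
  dirderiv v (act_fun rho g h) = act_fun rho g (dirderiv (rho g^-1%g v) h).
Proof. exact: dirderiv_comp. Qed.

Lemma act_funK g h : act_fun rho g (act_fun rho g^-1%g h) = h.
Proof.
by apply/funext => x; rewrite /act_fun invgK linear_actionVK.
Qed.

(** The kernel of $v \mapsto D_vf$ is stable: invariance gives $D_uf = g D_{u'}f$, so if $D_wf = 0$
    then $D_uD_{gw}f = g D_{u'}D_wf = 0$ for all $u$, and $D_{gw}f = 0$ by Euler. Irreducibility and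
    $f \neq 0$ make the kernel zero. *)
Lemma dirderiv_eq0 v : dirderiv v f = (fun=> 0) -> v = 0.
Proof.
have [|a u w Pu Pw|U UP] := @submod_vspace _ V (fun v => dirderiv v f = fun=> 0).
- exact: dirderiv0 formf.
- by apply/funext => x; rewrite (dirderiv_linear _ _ _ _ formf) Pu Pw mulr0 addr0.
have [|U0 /UP|UV _] := irr.2 U; last 1 first.
- case: f_neq0; apply: (form_dirderiv_eq0 formf) => w.
  by apply/UP; rewrite UV memvf.
- apply: invariant_vspace => // g w /UP Dw; apply/UP.
  apply: (form_dirderiv_eq0 (form_dirderiv _ formf)) => u.
  have [u' Du'] := Jacobian_form formf (act_Jacobian g^-1%g (dirderiv_Jacobian f u)).
  rewrite (dirderivC _ _ formf) -(act_funK g (dirderiv u f)) Du' dirderiv_act.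
  by rewrite linear_actionK // (dirderivC _ _ formf) Dw (dirderiv_cst 0).2.
- by rewrite U0 memv0 => /eqP.
Qed.

Lemma dirderiv_inj u v : dirderiv u f = dirderiv v f -> u = v.
Proof.
move=> Duv; apply/esym/eqP; rewrite -subr_eq0 addrC -scaleN1r; apply/eqP.
apply: dirderiv_eq0; apply/funext => x.
by rewrite (dirderiv_linear _ _ _ _ formf) Duv mulN1r addNr.
Qed.

(** Invariance of the Jacobian provides [M v] for each [v]; injectivity of $v \mapsto D_vf$ makes
    the choice unique, hence linear. *)
Lemma act_dirderiv g : exists M : 'End(V),
  forall v, dirderiv v (act_fun rho g f) = dirderiv (M v) f.
Proof.
have ex v : exists w, dirderiv v (act_fun rho g f) = dirderiv w f.
  apply: (Jacobian_form formf); rewrite dirderiv_act.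
  exact/act_Jacobian/dirderiv_Jacobian.
have [m mP] := choice ex.
have formh : form n.+3 (act_fun rho g f) by exact: form_comp.
have m_lin : linear m.
  move=> a u v; apply: dirderiv_inj; apply/funext => x.
  by rewrite -mP (dirderiv_linear _ _ _ _ formh) (dirderiv_linear _ _ _ _ formf) !mP.
pose mL : {linear V -> V} := HB.pack m (GRing.isLinear.Build _ _ _ _ m m_lin).
by exists (linfun mL) => v; rewrite lfunE mP.
Qed.

(** The Hessian is taken as the symmetric bilinear map $(v,w) \mapsto D_wD_vf$ with values in forms
    of degree $d-2$. *)
Definition hessian_selfadjoint (A : 'End(V)) := forall v w,
  dirderiv w (dirderiv (A v) f) = dirderiv (A w) (dirderiv v f).

(** With $T(x,y,z) = D_zD_yD_xf$, one has $T(ABx,y,z) = T(x,Ay,Bz) = T(BAx,y,z)$. Cancelling $z$ and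
    then $y$ uses that second and first derivatives of $f$ have positive degree, which is where $d
    \ge 3$ enters. *)
Lemma hessian_selfadjoint_comm A B :
  hessian_selfadjoint A -> hessian_selfadjoint B -> (A \o B = B \o A)%VF.
Proof.
move=> adjA adjB; apply/lfunP => x; rewrite !comp_lfunE; apply: dirderiv_inj.
have form2 u := form_dirderiv u formf.
have slots C D y z : hessian_selfadjoint C -> hessian_selfadjoint D ->
    dirderiv z (dirderiv y (dirderiv (C (D x)) f))
  = dirderiv (C y) (dirderiv (D z) (dirderiv x f)).
  move=> adjC adjD; transitivity (dirderiv z (dirderiv (C y) (dirderiv (D x) f))).
    by rewrite (adjC (D x) y).
  apply: (etrans (dirderivC z (C y) (form2 (D x)))).
  by rewrite (adjD x z).
apply: (form_dirderiv_inj (form2 _) (form2 _)) => y.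
apply: (form_dirderiv_inj (form_dirderiv _ (form2 _)) (form_dirderiv _ (form2 _))) => z.
apply: (etrans (slots A B y z adjA adjB)).
apply: (etrans (dirderivC (A y) (B z) (form2 x))).
apply: (etrans (esym (slots B A z y adjB adjA))).
exact: dirderivC (form2 (B (A x))).
Qed.

(** The Hessian of $gf$ is $D_wD_{Mv}f$, and it is symmetric. *)
Lemma act_hessian_selfadjoint g (M : 'End(V)) :
  (forall v, dirderiv v (act_fun rho g f) = dirderiv (M v) f) ->
  hessian_selfadjoint M.
Proof.
move=> MP v w; rewrite -MP (dirderivC w v (form_comp _ formf)) MP.
by rewrite (dirderivC _ _ formf).
Qed.

(* If D_v (g f) = D_(M v) f then A' = g A g^-1 is self-adjoint for the Hessian of
   g f, so M A' is self-adjoint for that of f; it thus commutes with M, and M can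
   be cancelled because it is invertible. *)
Lemma hessian_selfadjoint_conj g A : hessian_selfadjoint A ->
  hessian_selfadjoint (rho g \o (A \o rho g^-1%g))%VF.
Proof.
move=> adjA; set A' := (_ \o _)%VF; have [M MP] := act_dirderiv g.
have adjM := act_hessian_selfadjoint MP.
have A'E x : rho g^-1%g (A' x) = A (rho g^-1%g x).
  by rewrite /A' !comp_lfunE (linear_actionK rho_lin).
clearbody A'.
(* This is self-adjointness of [A'] for the Hessian of $gf$, transported from that of [A] for
   $f$. *)
have adjA' v w : dirderiv w (dirderiv (M (A' v)) f) = dirderiv (A' w) (dirderiv (M v) f).
  by rewrite -(MP (A' v)) -(MP v) !dirderiv_act !A'E adjA.
have adjMA' : hessian_selfadjoint (M \o A')%VF.
  by move=> v w; rewrite !comp_lfunE adjA' adjM.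
(* If $Mv = 0$ then $D_v(gf) = 0$, that is $D_{g^{-1}v}f = 0$, so $v = 0$. *)
have kerM : lker M == 0%VS.
  rewrite -subv0; apply/subvP => v; rewrite memv_ker memv0 => /eqP Mv0.
  have gv0 : rho g^-1%g v = 0.
    apply: dirderiv_eq0; apply/funext => x.
    have := congr1 (fun k => k (rho g x)) (MP v).
    by rewrite dirderiv_act Mv0 (dirderiv0 formf) /act_fun (linear_actionK rho_lin).
  by rewrite -(linear_actionVK rho_lin g v) gv0 linear0.
have MA' v : M (A' v) = A' (M v).
  have := hessian_selfadjoint_comm adjM adjMA'.
  move/lfunP/(_ v); rewrite !comp_lfunE; exact: (lker0P kerM).
(* Being injective in finite dimension, [M] is onto, so [v] may be replaced by [M u]. *)
move=> v w; rewrite -(lker0_lfunVK kerM v); set u := (M^-1)%VF v.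
by rewrite -(MA' u); exact: (adjA' u w).
Qed.

End InvariantJacobian.

(** * From scalar endomorphisms to the invariant line *)

Lemma act_proportional {K : numClosedFieldType} {G : groupType} {V : vectType K}
    (rho : G -> 'End(V)) n (f : V -> K) g :
  linear_action rho -> irreducible_module rho -> primitive_module rho ->
  form n.+3 f -> f <> (fun=> 0) -> invariant_fun rho (Jacobian f) ->
  exists c, act_fun rho g f = fun x => c * f x.
Proof.
move=> rho_lin irr prim formf f_neq0 invJ.
have [M MP] := act_dirderiv rho_lin irr formf f_neq0 invJ g.
have [c Mc] := primitive_normalized_scalar rho_lin irr prim
  (hessian_selfadjoint_comm rho_lin irr formf f_neq0 invJ)
  (hessian_selfadjoint_conj rho_lin irr formf f_neq0 invJ)
  (act_hessian_selfadjoint formf MP).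
have formh : form n.+3 (act_fun rho g f) by exact: form_comp.
(* Both sides have the same derivatives, since $D_v(gf) = D_{cv}f = D_v(cf)$. *)
exists c; apply: (form_dirderiv_inj formh (form_scale c formf)) => v.
rewrite MP Mc (dirderiv_scale _ (form_has_dirderiv formf)).2; apply/funext => x.
have := dirderiv_linear c v 0 x formf.
by rewrite (dirderiv0 formf) !addr0.
Qed.

Theorem theorem1p1 (R : realType) (G : groupType) (V : vectType R[i])
    (rho : G -> 'End(V)) (d : nat) (f : V -> R[i]) :
  linear_action rho ->
  irreducible_module rho ->
  primitive_module rho ->
  (3 <= d)%N ->
  sym_forms d f ->
  f <> (fun _ : V => 0) ->
  invariant_fun rho (Jacobian f) ->
  invariant_fun rho (line_fun f).
Proof.
move=> rho_lin irr prim d_ge3 /sym_forms_form formf f_neq0 invJ.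
case: d d_ge3 formf => [|[|[|n]]] // _ formf.
have act_line g k : line_fun f k -> line_fun f (act_fun rho g k).
  move=> [m [c [s [sf /funext ->]]]].
  have [a fa] := act_proportional g rho_lin irr prim formf f_neq0 invJ.
  (* Every [s i] equals [f], so the translated combination is one multiple of [f]. *)
  exists 1%N, (fun=> \sum_i c i * a), (fun=> f); split=> // x.
  rewrite big_ord1 mulr_suml /act_fun; apply: eq_bigr => i _.
  by rewrite (sf i) -mulrA -(congr1 (fun h => h x) fa).
move=> g; apply/seteqP; split=> [_ [k lk <-]|k lk]; first exact: act_line.
by exists (act_fun rho g^-1%g k); [exact: act_line | exact: act_funK].
Qed.
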